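(* Let $(\Omega,\mathfrak{F},P)$ be a probability space, let $X$ be a Bernoulli random variable on it (taking values in $\{0,1\}$), let $Y$ be a real valued random variable on it with $\mathrm{E}(|Y|)<\infty$, and let $Z$ be a random element on it with values in an arbitrary measurable space $(\mathfrak{S},\mathfrak{T})$. Then $$\mathrm{E}^{X,Z}(Y)=\mathrm{E}^{Z}(Y)+\frac{\mathrm{Cov}^Z(X,Y)}{\mathrm{Var}^Z(X)}\,[\mathrm{Var}^Z(X)>0]\,\big(X-\mathrm{E}^Z(X)\big).$$
   Context: Equalities between random variables hold $P$-almost surely. $\mathrm{E}^{Z}$ and $\mathrm{E}^{X,Z}$ denote conditional expectation given $\sigma(Z)$ and $\sigma(X,Z)$. An event is identified with its indicator function, so $[\mathrm{Var}^Z(X)>0]$ is the indicator of that event; the quotient times this indicator is taken to be $0$ where $\mathrm{Var}^Z(X)=0$. $\mathrm{Cov}^Z(X,Y)=\mathrm{E}^Z(XY)-\mathrm{E}^Z(X)\mathrm{E}^Z(Y)$ and $\mathrm{Var}^Z(X)=\mathrm{E}^Z(X^2)-(\mathrm{E}^Z(X))^2$. *)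

(* Defs.v *)
From HB Require Import structures.
From mathcomp Require Import all_boot all_order all_algebra.
From mathcomp Require Import all_classical all_reals all_analysis.
From mathcomp Require Import measurable_realfun.

Set Implicit Arguments.
Unset Strict Implicit.
Unset Printing Implicit Defensive.

Import Order.TTheory GRing.Theory Num.Theory.
Import numFieldNormedType.Exports.

Local Open Scope classical_set_scope.
Local Open Scope ring_scope.

(* [W] is a (real-valued, everywhere defined) version of the conditional
   expectation of [Y] given the sub-sigma-algebra [G]. Since [<<s G >> = G] for
   a sigma-algebra [G], the first clause says that [W] is [G]-measurable. *)
Definition is_cond_exp (d : measure_display) (T : measurableType d)
    (R : realType) (P : probability T R) (G : set_system T) (Y W : T -> R) :=
  [/\ measurable_fun [set: g_sigma_algebraType G] W,
      P.-integrable [set: T] (EFin \o W) &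
      forall A, G A ->
        \int[P]_(w in A) (W w)%:E = \int[P]_(w in A) (Y w)%:E]%E.

(* Versions exist, so a hypothesis [is_cond_exp P G Y W] on an arbitrary [W] is
   never vacuous for integrable [Y] and a sub-sigma-algebra [G]. *)
Lemma cond_exp_exists (d : measure_display) (T : measurableType d)
    (R : realType) (P : probability T R) (G : set_system T) (Y : T -> R) :
  sigma_algebra [set: T] G -> G `<=` measurable ->
  P.-integrable [set: T] (EFin \o Y) ->
  exists W, is_cond_exp P G Y W.
Proof.
move=> sG Gm iY.
pose TG := g_sigma_algebraType G.
have mG : (@measurable _ TG) = G := measurable_g_measurableTypeE sG.
pose f : T -> TG := fun x => x.
have mf : measurable_fun [set: T] f.
  by move=> _ A; rewrite mG setTI => /Gm.
pose fm : {mfun T >-> TG} := HB.pack f (@isMeasurableFun.Build _ _ T TG f mf).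
pose Q := distribution P fm.
pose pf : {charge set TG -> \bar R} := pushforward (induced_charge iY) fm.
pose nu := pf mf.
have nuQ : nu `<< Q.
  apply: dominates_pushforward => //.
  apply/null_content_dominatesP => A mA A0.
  apply: null_set_integral => //.
  by apply: (measurable_funS measurableT) (measurable_int _ iY).
pose h := Radon_Nikodym nu Q.
have ih : Q.-integrable [set: TG] h := Radon_Nikodym_integrable nuQ.
have finh x : h x \is a fin_num := Radon_Nikodym_fin_num x nuQ.
have hE : EFin \o (fine \o h) = h by apply/funext => x /=; rewrite fineK.
have mh := measurable_int _ ih.
have ihf : P.-integrable [set: T] (h \o f).
  apply/integrableP; split; first exact: (measurable_comp measurableT _ mh mf).
  case/integrableP: (ih) => _.
  rewrite ge0_integral_pushforward //.
  exact: measurable_int (integrable_abse ih).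
exists (fine \o h); split.
- apply: (measurable_comp measurableT _ _ mh) => //; exact: fine_measurable.
- by have -> : EFin \o (fine \o h) = h \o f by exact: hE.
- move=> A GA.
  have mA : @measurable _ TG A by rewrite mG.
  have := Radon_Nikodym_integral nuQ mA.
  rewrite integral_pushforward//; last first.
    by apply: (integrableS measurableT _ _ ihf) => //; exact: Gm.
  move=> /esym nuE; apply: etrans nuE.
  by apply: eq_integral => x _; exact: fineK.
Qed.

(* [Cov^Z(X,Y) = E^Z(XY) - E^Z(X) E^Z(Y)] and [Var^Z(X) = E^Z(X^2) - E^Z(X)^2],
   as functions of chosen versions of the conditional expectations involved. *)
Definition cond_cov (T : Type) (R : realType) (EXY EX EY : T -> R) : T -> R :=
  fun w => EXY w - EX w * EY w.

Definition cond_var (T : Type) (R : realType) (EXX EX : T -> R) : T -> R :=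
  fun w => EXX w - EX w ^+ 2.

(* Main.v *)
Require Import Defs.
From mathcomp Require Import all_boot all_order all_algebra.
From mathcomp Require Import all_classical all_reals all_analysis.
From mathcomp Require Import measurable_realfun.
From mathcomp Require Import ring lra.
Import Order.TTheory GRing.Theory Num.Theory.
Import numFieldNormedType.Exports.
Local Open Scope classical_set_scope.
Local Open Scope ring_scope.

(** Fix an event [E], let [p] and [q] be versions of the conditional expectations
of [1_E] and [1_E Y] given [G = sigma(Z)], and let [V] be one of [Y] given
[H = sigma(X, Z)].  When [E] is a level set of [X], the sets of [H] have on [E]
the same traces as the sets of [G] ([trace_preimageU]), so that on [E] the
variable [V] behaves like the elementary conditional mean: [V p = q] almost
surely on [E], with [p > 0] there ([cond_exp_atom], [cond_prob_gt0]).

No product has to be pulled out of a conditional expectation.  If [V < q / p]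
on a nonnull part of [E], some rational [a] separates the two sides on a nonnull
part.  The set where [V < a] has on [E] the trace of some [C] in [G].  Let [B] be
the part of [C] where [a p < q].  The integral over [B] of the negative function
[a p - q] is that of [a - Y] over [B `&` E], a set of [H], hence that of [a - V]
over a set where [V < a]: it is nonnegative, and [B] is null.

Taking [E] to be [X = 1] and [X = 0], with [p = E^Z(X)], [q = E^Z(XY)] in the
first case and [1 - p], [E^Z(Y) - q] in the second, gives two equations that
determine [E^{X,Z}(Y)].  As [X^2 = X], the conditional variance is [p (1 - p)],
and the regression formula is the interpolation between these two values
([two_point_regression]).  Where the variance vanishes, [p] is 0 or 1, and
[E^Z(1_E Y)] vanishes with the probability of [E] ([cond_exp_indic_eq0]), which
leaves [E^{X,Z}(Y) = E^Z(Y)]. *)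

(** * Conditional expectations given a sub-sigma-algebra *)

Section CondExp.
#[local] Set Implicit Arguments.
#[local] Unset Strict Implicit.
Context (d : measure_display) (T : measurableType d) (R : realType)
  (P : probability T R).
Implicit Types (A B : set T).

Lemma integral_lt0_null (A : set T) (f : T -> R) :
  measurable A -> P.-integrable A (EFin \o f) ->
  (forall w, A w -> f w < 0) -> (0 <= \int[P]_(w in A) (f w)%:E)%E ->
  P.-negligible A.
Proof.
move=> mA fi f0 If.
have absf : (\int[P]_(w in A) `|(f w)%:E| = 0)%E.
  apply/eqP; rewrite eq_le integral_ge0// andbT.
  have -> : (\int[P]_(w in A) `|(f w)%:E| = - \int[P]_(w in A) (f w)%:E)%E.
    rewrite -integralN /=; last exact: integrable_add_def.
    apply: eq_integral => w /set_mem Aw.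
    by rewrite /= ltr0_norm ?f0.
  by rewrite leeNl oppe0.
have /(ae_eq_integral_abs P mA (measurable_int _ fi)) := absf.
move=> [N [mN N0 subN]]; exists N; split => // w Aw.
by apply: subN => /= /(_ Aw) [] fw; have := f0 w Aw; rewrite fw ltxx.
Qed.

Lemma integral_indicM (A E : set T) (f : T -> R) :
  (\int[P]_(w in A) (\1_E w * f w)%:E = \int[P]_(w in A `&` E) (f w)%:E)%E.
Proof.
rewrite integral_mkcondr; apply: eq_integral => w _.
rewrite /patch indicE; case: ifPn => _; first by rewrite mul1r.
by rewrite mul0r.
Qed.

Lemma integrable_indicM (E : set T) (f : T -> R) : measurable E ->
  P.-integrable setT (EFin \o f) ->
  P.-integrable setT (EFin \o (fun w => \1_E w * f w)).
Proof.
move=> mE fi; apply: le_integrable (fi) => //.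
  apply/measurable_EFinP; apply: measurable_funM => //.
  by have /measurable_EFinP := measurable_int _ fi.
move=> w _ /=; rewrite lee_fin normrM indicE.
by case: (w \in E); rewrite ?normr1 ?normr0 ?mul1r ?mul0r.
Qed.

Section Sigma.
Context (G : set_system T) (sG : sigma_algebra [set: T] G)
  (Gm : G `<=` measurable).

Local Notation TG := (g_sigma_algebraType G).

Lemma sub_sigma_setC A : G A -> G (~` A).
Proof. by case: sG => _ + _ => /[apply]; rewrite setTD. Qed.

Lemma sub_sigma_setI A B : G A -> G B -> G (A `&` B).
Proof. by move/sigma_algebraP: sG => [] // _ _ _; exact. Qed.

Lemma sub_sigma_lt0 (f : T -> R) :
  measurable_fun [set: TG] f -> G [set w | f w < 0].
Proof.
move=> mf; rewrite -{1}(measurable_g_measurableTypeE sG).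
have := mf measurableT _ (measurable_itv `]-oo, 0[); rewrite setTI.
by congr measurable; apply/seteqP; split => w /=; rewrite in_itv.
Qed.

Lemma cond_exp_lin (a b : R) (U U' W W' : T -> R) :
  P.-integrable setT (EFin \o U) -> P.-integrable setT (EFin \o U') ->
  is_cond_exp P G U W -> is_cond_exp P G U' W' ->
  is_cond_exp P G (fun w => a * U w + b * U' w) (fun w => a * W w + b * W' w).
Proof.
move=> iU iU' [mW iW IW] [mW' iW' IW'].
have lin (f g : T -> R) A : G A -> P.-integrable setT (EFin \o f) ->
  P.-integrable setT (EFin \o g) ->
  (\int[P]_(w in A) (a * f w + b * g w)%:E =
   a%:E * \int[P]_(w in A) (f w)%:E + b%:E * \int[P]_(w in A) (g w)%:E)%E.
  move=> /Gm mA fi gi.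
  have fA := integrableS measurableT mA (@subsetT _ _) fi.
  have gA := integrableS measurableT mA (@subsetT _ _) gi.
  rewrite -!integralZl// -integralD//; exact: integrableZl.
split.
- by apply: measurable_funD; exact: measurable_funM.
- have := integrableD measurableT (integrableZl measurableT a iW)
    (integrableZl measurableT b iW').
  by [].
- by move=> A GA; rewrite !lin// IW// IW'.
Qed.

Lemma cond_exp_id (U : T -> R) : measurable_fun [set: TG] U ->
  P.-integrable setT (EFin \o U) -> is_cond_exp P G U U.
Proof. by []. Qed.

(** The integrals of [W] and [U] over [A] agree, so a negative [W] contradicts the
sign of the latter unless [A] is null.  The almost sure comparisons below apply
this to a well chosen [A]. *)
Lemma cond_exp_lt0_null (U W : T -> R) A : is_cond_exp P G U W -> G A ->
  (forall w, A w -> W w < 0) -> (0 <= \int[P]_(w in A) (U w)%:E)%E ->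
  P.-negligible A.
Proof.
move=> [mW iW IW] GA W0 IU; apply: (integral_lt0_null (f := W)) => //.
- exact: Gm.
- by apply: integrableS iW => //; exact: Gm.
- by rewrite IW.
Qed.


Lemma cond_exp_ae_unique (U W W' : T -> R) :
  P.-integrable setT (EFin \o U) ->
  is_cond_exp P G U W -> is_cond_exp P G U W' -> W = W' %[ae P].
Proof.
move=> iU.
have half V V' : is_cond_exp P G U V -> is_cond_exp P G U V' ->
    P.-negligible [set w | V w < V' w].
  move=> hV hV'; have h := cond_exp_lin 1 (-1) iU iU hV hV'.
  have -> : [set w | V w < V' w] = [set w | 1 * V w + -1 * V' w < 0].
    by apply/seteqP; split => w /=; lra.
  apply: (cond_exp_lt0_null h) => //; first by case: h => /sub_sigma_lt0.
  rewrite (_ : (\int[P]_(w in _) _ = 0)%E)//.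
  by apply: integral0_eq => w _; congr EFin; lra.
move=> hW hW'; apply: negligibleS (negligibleU (half _ _ hW hW') (half _ _ hW' hW)).
move=> w /= ne; have [|//|e] := ltgtP (W w) (W' w); [by left|by right|].
by exfalso; apply: ne.
Qed.

End Sigma.

(** * Behaviour on the trace of an event *)

Section Atom.
Context (G : set_system T) (sG : sigma_algebra [set: T] G)
  (Gm : G `<=` measurable) (E : set T) (mE : measurable E).
Local Notation indM Y := (fun w => \1_E w * Y w).

Let int1 : P.-integrable setT (EFin \o (\1_E : T -> R)).
Proof. exact: integrable_indic. Qed.

Let sub_sigma_le0 (f : T -> R) :
  measurable_fun [set: g_sigma_algebraType G] f -> G [set w | f w <= 0].
Proof.
move=> mf; have -> : [set w | f w <= 0] = ~` [set w | - f w < 0].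
  by apply/seteqP; split => w /=; rewrite oppr_lt0 leNgt => /negP.
by apply: (sub_sigma_setC sG); apply: (sub_sigma_lt0 sG); exact: measurable_funN.
Qed.

Let integral_ind A : measurable A ->
  (\int[P]_(w in A) (\1_E w : R)%:E = P (A `&` E))%E.
Proof. by move=> mA; rewrite integral_indic// setIC. Qed.

Lemma cond_prob_ge0 (p : T -> R) : is_cond_exp P G \1_E p ->
  {ae P, forall w, 0 <= p w}.
Proof.
move=> hp; have [mp _ _] := hp.
have -> : {ae P, forall w, 0 <= p w} = P.-negligible [set w | p w < 0].
  rewrite /prop_near1 /nbhs /= /almost_everywhere; congr (P.-negligible _).
  by apply/seteqP; split => w /=; rewrite ltNge => /negP.
apply: (cond_exp_lt0_null Gm hp) => //; first exact: (sub_sigma_lt0 sG).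
by apply: integral_ge0 => w _; rewrite lee_fin.
Qed.

Let cond_prob_le0_null (p : T -> R) : is_cond_exp P G \1_E p ->
  P ([set w | p w <= 0] `&` E) = 0.
Proof.
move=> [mp ip Ip].
have GA := sub_sigma_le0 mp; have mA := Gm GA.
have pE := Ip _ GA; rewrite integral_ind// in pE.
have ipA := integrableS measurableT mA (@subsetT _ _) ip.
apply/eqP; rewrite eq_le measure_ge0 andbT -pE -oppe_ge0 -integralN /=; last first.
  exact: integrable_add_def.
by apply: integral_ge0 => w /= pw; rewrite lee_fin oppr_ge0.
Qed.

(** The event [E] meets [p <= 0] in a null set, since its probability there is the
integral of [p]. *)
Lemma cond_prob_gt0 (p : T -> R) : is_cond_exp P G \1_E p ->
  {ae P, forall w, E w -> 0 < p w}.
Proof.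
move=> hp; have [mp _ _] := hp.
have n0 : P.-negligible ([set w | p w <= 0] `&` E).
  apply/negligibleP; last exact: cond_prob_le0_null.
  by apply: measurableI => //; apply: Gm; exact: sub_sigma_le0.
apply: negligibleS n0 => w /= /not_implyP[Ew /negP].
by rewrite -leNgt.
Qed.

(** Over any part of [p <= 0] in [G] the integral of [q] is that of [Y] over a null
part of [E], hence zero; so neither [q < 0] nor [q > 0] can hold there. *)
Lemma cond_exp_indic_eq0 (p q Y : T -> R) :
  P.-integrable setT (EFin \o Y) ->
  is_cond_exp P G \1_E p -> is_cond_exp P G (indM Y) q ->
  {ae P, forall w, p w <= 0 -> q w = 0}.
Proof.
move=> iY hp hq; have [mp _ _] := hp; have [mq _ _] := hq.
have iEY := integrable_indicM mE iY.
pose A := [set w | p w <= 0]; have GA : G A by exact: sub_sigma_le0.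
(* The values 1 and -1 of [a] treat [q < 0] and [q > 0] alike. *)
have half (a : R) : P.-negligible (A `&` [set w | a * q w + 0 * q w < 0]).
  have h := cond_exp_lin Gm a 0 iEY iEY hq hq.
  have GB : G (A `&` [set w | a * q w + 0 * q w < 0]).
    by apply: (sub_sigma_setI sG) => //; case: h => /(sub_sigma_lt0 sG).
  apply: (cond_exp_lt0_null Gm h GB) => [w []//|].
  under eq_integral do rewrite mul0r addr0 mulrCA.
  rewrite integral_indicM null_set_integral//.
  - by apply: measurableI => //; exact: Gm.
  - have maY : measurable_fun setT (fun w => (a * Y w)%:E).
      apply/measurable_EFinP; apply: measurable_funM => //.
      by have /measurable_EFinP := measurable_int _ iY.
    exact: measurable_funS measurableT (@subsetT _ _) maY.
  - apply: subset_measure0 (cond_prob_le0_null hp) => //.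
    + by apply: measurableI => //; exact: Gm.
    + by apply: measurableI => //; exact: Gm.
    + by move=> w [[Aw _] Ew].
apply: negligibleS (negligibleU (half 1) (half (-1))) => w /=.
move=> /not_implyP[pw /eqP qw].
by rewrite /A/=; case: (ltgtP (q w) 0) qw => // q0 _; [left|right]; split => //; lra.
Qed.

Context (H : set_system T) (sH : sigma_algebra [set: T] H)
  (Hm : H `<=` measurable)
  (traceHG : forall A, H A -> exists2 B, G B & A `&` E = B `&` E)
  (traceGH : forall B, G B -> H (B `&` E)).

(** On [E], the sigma-algebra [H] does not see more than [G].  If [V < q / p]
on part of [E], a rational [a] lies between; for each [a], the exceptional set is
the trace on [E] of a set of [G] on which [cond_exp_lt0_null] applies to
[a p - q], the conditional expectation of [1_E (a - Y)]. *)
Lemma cond_exp_atom_le (p q Y V : T -> R) :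
  P.-integrable setT (EFin \o Y) ->
  is_cond_exp P G \1_E p -> is_cond_exp P G (indM Y) q ->
  is_cond_exp P H Y V ->
  {ae P, forall w, E w -> q w <= V w * p w}.
Proof.
move=> iY hp hq hV.
have iEY := integrable_indicM mE iY.
have i1 : P.-integrable setT (EFin \o cst (1 : R)).
  exact: finite_measure_integrable_cst.
have H1 : is_cond_exp P H (cst 1) (cst 1) by apply: cond_exp_id.
have null (a : R) : P.-negligible
    ((E `&` [set w | V w < a]) `&` [set w | a * p w < q w]).
  have hW := cond_exp_lin Gm (-1) a iEY int1 hq hp.
  have hVa := cond_exp_lin Hm (-1) a iY i1 hV H1.
  have -> : [set w | a * p w < q w] = [set w | -1 * q w + a * p w < 0].
    by apply/seteqP; split => w /=; lra.
  have HV : H [set w | V w < a].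
    have -> : [set w | V w < a] = [set w | 1 * V w + (- a) * 1 < 0].
      by apply/seteqP; split => w /=; lra.
    by case: (cond_exp_lin Hm 1 (- a) iY i1 hV H1) => /(sub_sigma_lt0 sH).
  have [C GC EC] := traceHG HV.
  have GB : G (C `&` [set w | -1 * q w + a * p w < 0]).
    by apply: (sub_sigma_setI sG) => //; case: hW => /(sub_sigma_lt0 sG).
  apply: (negligibleS _ (cond_exp_lt0_null Gm hW GB _ _)) => [w [EVw]||].
  - by move: EVw; rewrite setIC EC => -[].
  - by move=> w [].
  - under eq_integral do rewrite mulrCA [a * _]mulrC -mulrDr.
    rewrite integral_indicM.
    have HD := traceGH GB.
    have [_ _ /(_ _ HD) ID] := hVa.
    rewrite (eq_integral (fun w => (-1 * Y w + a * cst 1 w)%:E)); last first.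
      by move=> w _; rewrite mulr1.
    rewrite -ID; apply: integral_ge0 => w [[Cw _] Ew]; rewrite lee_fin.
    have : (C `&` E) w by [].
    by rewrite -EC => -[/= Vw _]; lra.
(* Sequence of the exceptional sets, indexed by codes of rationals. *)
pose F k := if @unpickle rat k is Some a then
  (E `&` [set w | V w < ratr a]) `&` [set w | ratr a * p w < q w] else set0.
have Fae : {ae P, forall w, ~ (\bigcup_k F k) w}.
  suff : P.-negligible (\bigcup_k F k) by apply: negligibleS => w /= /contrapT.
  apply: negligible_bigcup => k; rewrite /F.
  by case: unpickle => [a|]; [exact: null|exact: negligible_set0].
have pos := cond_prob_gt0 hp.
move: Fae pos; apply: filterS2 => w nF p0 Ew.
have {}p0 := p0 Ew; rewrite leNgt; apply/negP => Vq; apply: nF.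
have /rat_in_itvoo[a] : V w < q w / p w by rewrite ltr_pdivlMr.
rewrite in_itv /= => /andP[Va aq]; exists (pickle a); first exact: I.
rewrite /F pickleK; split; first by split.
by rewrite /= -ltr_pdivlMr.
Qed.

(** The opposite inequality is the previous one for [- Y]. *)
Lemma cond_exp_atom (p q Y V : T -> R) :
  P.-integrable setT (EFin \o Y) ->
  is_cond_exp P G \1_E p -> is_cond_exp P G (indM Y) q ->
  is_cond_exp P H Y V ->
  {ae P, forall w, E w -> V w * p w = q w}.
Proof.
move=> iY hp hq hV.
have iEY := integrable_indicM mE iY.
have iNY : P.-integrable setT (EFin \o (fun w => -1 * Y w + 0 * Y w)).
  have := integrableD measurableT (integrableZl measurableT (-1) iY)
    (integrableZl measurableT 0 iY).
  by [].
have hNV := cond_exp_lin Hm (-1) 0 iY iY hV hV.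
have hNq : is_cond_exp P G (indM (fun w => -1 * Y w + 0 * Y w))
    (fun w => -1 * q w + 0 * q w).
  have := cond_exp_lin Gm (-1) 0 iEY iEY hq hq.
  by congr is_cond_exp; apply/funext => w; ring.
have le1 := cond_exp_atom_le iY hp hq hV.
have le2 := cond_exp_atom_le iNY hp hNq hNV.
move: le1 le2; apply: filterS2 => w + + Ew => /(_ Ew) le1 /(_ Ew) le2.
by apply/eqP; rewrite eq_le; apply/andP; split; lra.
Qed.
End Atom.
End CondExp.

(** * Sigma-algebras generated by random elements *)

Section Generated.
#[local] Set Implicit Arguments.
#[local] Unset Strict Implicit.
Context (d d1 d2 : measure_display) (T : measurableType d)
  (S1 : measurableType d1) (S2 : measurableType d2) (R : realType)
  (P : probability T R).

Lemma sigma_algebra_RV (Z : {RV P >-> S2}) :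
  sigma_algebra [set: T] (g_sigma_algebra_preimage Z).
Proof. by apply: sigma_algebra_preimage; exact: sigma_algebra_measurable. Qed.

Lemma RV_preimage_sub d' (S' : measurableType d') (Z : {RV P >-> S'}) :
  g_sigma_algebra_preimage Z `<=` measurable.
Proof. by move=> _ [B mB <-]; apply: (measurable_funP Z). Qed.

Context (X : {RV P >-> S1}) (Z : {RV P >-> S2}).

Lemma RV_preimageU_sub : g_sigma_preimageU X Z `<=` measurable.
Proof.
apply: smallest_sub; first exact: sigma_algebra_measurable.
by move=> A [|]; exact: RV_preimage_sub.
Qed.

Lemma RV_preimageU_sigma : sigma_algebra [set: T] (g_sigma_preimageU X Z).
Proof. exact: smallest_sigma_algebra. Qed.

(** The sets with this property form a sigma-algebra, which contains the events
of [Z] and also those of [X], as [X] is constant on the level set. *)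
Lemma trace_preimageU (x : S1) A : g_sigma_preimageU X Z A ->
  exists2 B, g_sigma_algebra_preimage Z B &
    A `&` X @^-1` [set x] = B `&` X @^-1` [set x].
Proof.
set E := X @^-1` _; pose C := [set A | exists2 B, g_sigma_algebra_preimage Z B &
  A `&` E = B `&` E].
have sZ := sigma_algebra_RV Z; have [Z0 ZC ZU] := sZ.
have sC : sigma_algebra [set: T] C.
  split; first by exists set0.
  - move=> A' [B ZB AB]; rewrite setTD; exists (~` B); first by rewrite -setTD; exact: ZC.
    apply/seteqP; split => w /= [nAw Ew]; split => //.
      by move=> Bw; apply: nAw; have : (B `&` E) w by []; rewrite -AB => -[].
    by move=> Aw; apply: nAw; have : (A' `&` E) w by []; rewrite AB => -[].
  - move=> F FC; have /choice[B HB] : forall n, exists B,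
        g_sigma_algebra_preimage Z B /\ F n `&` E = B `&` E.
      by move=> n; have [B ZB FB] := FC n; exists B.
    exists (\bigcup_n B n); first by apply: ZU => n; case: (HB n).
    by rewrite !setI_bigcupl; apply: eq_bigcupr => n _; case: (HB n).
move: A; apply: smallest_sub => // A [[B mB <-]|ZA]; last by exists A.
rewrite setTI; have [Bx|nBx] := pselect (B x).
  exists setT; first by rewrite -[setT]setC0 -setTD; exact: ZC.
  by rewrite setTI; apply/seteqP; split => w /= => [[]//|Ew]; split => //=; rewrite Ew.
by exists set0 => //; rewrite set0I; apply/seteqP; split => w //= [] + Ew; rewrite Ew.
Qed.

Lemma preimageU_setI (x : S1) B : measurable [set x] ->
  g_sigma_algebra_preimage Z B -> g_sigma_preimageU X Z (B `&` X @^-1` [set x]).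
Proof.
move=> mx ZB; apply: (sub_sigma_setI RV_preimageU_sigma).
  by apply: sub_sigma_algebra; right.
by apply: sub_sigma_algebra; left; exists [set x] => //; rewrite setTI.
Qed.

End Generated.

(** * The regression formula *)

(** Here [x] is the value of [X], [p], [q], [y] those of the conditional expectations
of [X], [XY], [Y] given [Z], and [v] that of the conditional expectation of [Y]
given [X] and [Z]. *)
Lemma two_point_regression (R : realFieldType) (p y q v x : R) :
  x = 0 \/ x = 1 ->
  (x = 1 -> v * p = q) ->
  (x = 0 -> v * (1 - p) = y - q) ->
  (p <= 0 -> q = 0) ->
  (1 - p <= 0 -> y - q = 0) ->
  0 <= p ->
  0 <= 1 - p -> (x = 1 -> 0 < p) -> (x = 0 -> 0 < 1 - p) ->
  v = y + (q - p * y) / (p * (1 - p)) * (0 < p * (1 - p))%R%:R * (x - p).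
Proof.
move=> x01 v1 v0 q0 yq0 p_ge0 p_le1 p_gt0 p_lt1.
have [pp|pp] := ltP 0 (p * (1 - p)); rewrite ?mulr1 ?mulr0 ?mul0r ?addr0.
  have p_neq0 : p != 0 by apply: contraTneq pp => ->; rewrite mul0r ltxx.
  have p_neq1 : 1 - p != 0 by apply: contraTneq pp => ->; rewrite mulr0 ltxx.
  case: x01 => xE; rewrite xE.
    apply: (mulIf p_neq1); rewrite v0//.
    by field; rewrite p_neq0 p_neq1.
  apply: (mulIf p_neq0); rewrite v1//.
  by field; rewrite p_neq0 p_neq1.
case: x01 => xE.
  have lt1 := p_lt1 xE.
  have p0 : p <= 0.
    by rewrite leNgt; apply/negP => p0; move: pp; rewrite leNgt mulr_gt0.
  have := v0 xE; rewrite q0// (_ : p = 0) ?subr0 ?mulr1//; lra.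
have gt0 := p_gt0 xE.
have p1 : 1 - p <= 0.
  by rewrite leNgt; apply/negP => p0; move: pp; rewrite leNgt mulr_gt0.
have := v1 xE; have := yq0 p1; rewrite (_ : p = 1) ?mulr1; lra.
Qed.

Theorem mainTheorem2 (d d' : measure_display) (T : measurableType d)
    (S : measurableType d') (R : realType) (P : probability T R)
    (X Y : {RV P >-> R}) (Z : {RV P >-> S})
    (X01 : forall w, X w = 0 \/ X w = 1)
    (intY : P.-integrable [set: T] (EFin \o Y))
    (EZ_X EZ_Y EZ_XY EZ_XX EXZ_Y : T -> R)
    (hEZ_X : is_cond_exp P (g_sigma_algebra_preimage Z) X EZ_X)
    (hEZ_Y : is_cond_exp P (g_sigma_algebra_preimage Z) Y EZ_Y)
    (hEZ_XY : is_cond_exp P (g_sigma_algebra_preimage Z)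
                (fun w => X w * Y w) EZ_XY)
    (hEZ_XX : is_cond_exp P (g_sigma_algebra_preimage Z)
                (fun w => X w ^+ 2) EZ_XX)
    (hEXZ_Y : is_cond_exp P (g_sigma_preimageU X Z) Y EXZ_Y) :
  let Cov := cond_cov EZ_XY EZ_X EZ_Y in
  let Var := cond_var EZ_XX EZ_X in
  EXZ_Y = (fun w => EZ_Y w +
             Cov w / Var w * \1_[set v | 0 < Var v] w * (X w - EZ_X w))
    %[ae P].
Proof.
set G := g_sigma_algebra_preimage Z; set H := g_sigma_preimageU X Z => Cov Var.
have sG : sigma_algebra [set: T] G := sigma_algebra_RV Z.
have Gm : G `<=` measurable by exact: RV_preimage_sub.
have sH : sigma_algebra [set: T] H by exact: RV_preimageU_sigma.
have Hm : H `<=` measurable by exact: RV_preimageU_sub.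
pose E x := X @^-1` [set x].
have mE x : measurable (E x) by rewrite -[E x]setTI; apply: (measurable_funP X).
have indE x w : \1_(E x) w = (X w == x)%R%:R :> R.
  by rewrite indicE; congr (_ : bool)%:R; apply/idP/eqP => [/set_mem|Xw]; last exact/mem_set.
have ind1 : \1_(E 1) = X :> (T -> R).
  apply/funext => w; rewrite indE.
  by case: (X01 w) => ->; rewrite ?eqxx// eq_sym oner_eq0.
have ind0 : \1_(E 0) = (fun w => 1 - \1_(E 1) w) :> (T -> R).
  apply/funext => w; rewrite !indE.
  by case: (X01 w) => ->; rewrite ?eqxx ?oner_eq0 ?[0 == 1]eq_sym ?oner_eq0 /=; ring.
have i1 : P.-integrable setT (EFin \o cst (1 : R)).
  exact: finite_measure_integrable_cst.
have iE1 : P.-integrable setT (EFin \o (\1_(E 1) : T -> R)).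
  exact: integrable_indic.
have iE1Y := integrable_indicM (mE 1) intY.
have hp1 : is_cond_exp P G \1_(E 1) EZ_X by rewrite ind1.
have hq1 : is_cond_exp P G (fun w => \1_(E 1) w * Y w) EZ_XY by rewrite ind1.
have hp0 : is_cond_exp P G \1_(E 0) (fun w => 1 - EZ_X w).
  have h1 : is_cond_exp P G (cst 1) (cst 1) by apply: cond_exp_id.
  have := cond_exp_lin Gm 1 (-1) i1 iE1 h1 hp1.
  by rewrite ind0; congr is_cond_exp; apply/funext => w /=; ring.
have hq0 : is_cond_exp P G (fun w => \1_(E 0) w * Y w)
    (fun w => EZ_Y w - EZ_XY w).
  have := cond_exp_lin Gm 1 (-1) intY iE1Y hEZ_Y hq1.
  by rewrite ind0; congr is_cond_exp; apply/funext => w; ring.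
have tHG x A : H A -> exists2 B, G B & A `&` E x = B `&` E x.
  exact: trace_preimageU.
have tGH x B : G B -> H (B `&` E x) by apply: preimageU_setI.
have XX : EZ_XX = EZ_X %[ae P].
  apply: (cond_exp_ae_unique sG Gm iE1 _ hp1); rewrite ind1.
  move: hEZ_XX; congr is_cond_exp; apply/funext => w.
  by case: (X01 w) => ->; rewrite expr2 ?mulr0 ?mulr1.
(* The two equations, on [X = 1] and on [X = 0]. *)
have V1 := cond_exp_atom sG Gm (mE 1) sH Hm (tHG 1) (tGH 1) intY hp1 hq1 hEXZ_Y.
have V0 := cond_exp_atom sG Gm (mE 0) sH Hm (tHG 0) (tGH 0) intY hp0 hq0 hEXZ_Y.
have pos1 := cond_prob_gt0 sG Gm (mE 1) hp1.
have pos0 := cond_prob_gt0 sG Gm (mE 0) hp0.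
have z1 := cond_exp_indic_eq0 sG Gm (mE 1) intY hp1 hq1.
have z0 := cond_exp_indic_eq0 sG Gm (mE 0) intY hp0 hq0.
have ge1 := cond_prob_ge0 sG Gm hp1.
have ge0 := cond_prob_ge0 sG Gm hp0.
move: V1; apply: filter_app.
move: V0; apply: filter_app.
move: pos1; apply: filter_app.
move: pos0; apply: filter_app.
move: XX; apply: filter_app.
move: z1; apply: filter_app.
move: z0; apply: filter_app.
move: ge1; apply: filter_app.
move: ge0; apply: filter_app.
apply: aeW => w g0 g1 y0 y1 /(_ I) xx p0 p1 v0 v1 _.
have reg : EXZ_Y w = EZ_Y w + (EZ_XY w - EZ_X w * EZ_Y w) /
    (EZ_X w * (1 - EZ_X w)) * (0 < EZ_X w * (1 - EZ_X w))%R%:R * (X w - EZ_X w).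
  exact: two_point_regression.
have VarE : Var w = EZ_X w * (1 - EZ_X w) by rewrite /Var /cond_var xx; ring.
apply: (etrans reg); rewrite /= indicE -VarE; congr (_ + _ / _ * (_ : bool)%:R * _).
by apply/idP/idP => [?|/set_mem]; first exact/mem_set.
Qed.
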